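(* Let $A$ be an $n\times n$ symmetrizable generalized Cartan matrix, let $({\bf i},{\bf j})$ be a pair of $[1,n]$-sequences, let $T$ be a triangulation of the trapezoid $S_{\bf j}^{\bf i}(A)$, and let $B$ be the exchange matrix of $T$. Then $B$ belongs to $\mathcal P'$, the smallest class of skew-symmetrizable matrices that contains the $1\times 1$ zero matrix and is closed under mutations and source-sink extensions.
   Context: **Cartan matrices.** A symmetrizable generalized Cartan matrix is an integer matrix $A=(a_{ij})_{n\times n}$ with $a_{ii}=2$ for all $i$; $a_{ij}\le 0$ for $i\ne j$; $a_{ij}=0$ if and only if $a_{ji}=0$; and such that there is an integer diagonal matrix $S=\mathrm{Diag}(s_1,\dots,s_n)$ with all $s_i>0$ and $SA$ symmetric. **Skew-symmetrizable matrices and mutation.** Matrices are indexed by finite sets. An integer matrix $B=(b_{ij})_{i,j\in I}$ is skew-symmetrizable if there is an integer diagonal matrix $S=\mathrm{Diag}(s_i)_{i\in I}$ with all $s_i>0$ such that $SB$ is skew-symmetric. Its mutation in direction $k\in I$ is $\mu_k(B)=(b'_{ij})_{i,j\in I}$ with $b'_{ij}=-b_{ij}$ if $i=k$ or $j=k$, and $b'_{ij}=b_{ij}+\mathrm{sgn}(b_{ik})\max\{b_{ik}b_{kj},0\}$ otherwise. **Source-sink extensions and $\mathcal P'$.** Let $B=(b_{ij})_{i,j\in I}$ be skew-symmetrizable, let $I'=\{v\}$ be a one-element set and $J=I\sqcup I'$. A skew-symmetrizable matrix $C=(c_{ij})_{i,j\in J}$ is a source-sink extension of $B$ if $c_{ij}=b_{ij}$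 for all $i,j\in I$, $c_{vv}=0$, and either $c_{iv}\ge 0$ for all $i\in I$ or $c_{iv}\le 0$ for all $i\in I$. The class $\mathcal P'$ is the smallest class of skew-symmetrizable matrices such that: the $1\times1$ zero matrix (with any one-element index set) belongs to $\mathcal P'$; $\mathcal P'$ is closed under mutations; $\mathcal P'$ is closed under source-sink extensions. By convention the empty matrix (empty index set) also belongs to $\mathcal P'$. **Triangulations.** A $[1,n]$-sequence is a finite (possibly empty) sequence ${\bf i}=(i_1,\dots,i_{\ell({\bf i})})$ with entries in $\{1,\dots,n\}$. For a pair $({\bf i},{\bf j})$ of $[1,n]$-sequences, $S_{\bf j}^{\bf i}(A)$ is a trapezoid with top base of length $\ell({\bf i})$ and bottom base of length $\ell({\bf j})$, whose unit intervals are labeled from left to right by the entries of ${\bf i}$ (top) and of ${\bf j}$ (bottom). A triangulation $T$ is a collection of line segments (diagonals), each joining a marked point (endpoint of a unit interval) on the top to one on the bottom, dividing the trapezoid into triangles. Each of the $\ell({\bf i})+\ell({\bf j})$ triangles has exactly one unit interval, top or bottom, as an edge, and the triangles are linearly ordered from left to right; so a triangulation is the same as a shuffle of ${\bf i}$ and ${\bf j}$ (remembering which entries come from ${\bf i}$ and which from ${\bf j}$). **String diagram.** Draw $n$ horizontal lines (levels $1,\dots,n$) across the trapezoid. In each triangle whose bottom edge is labeled $k$, put a node labeled $k$ on level $k$; in each triangle whose top edge is labeled $k$, put a node labeled $-k$ on level $k$. Thus each triangle contains exactly one node. The nodes cut the lines into strings; a string with nodes at both ends is called closed, the others are called open. The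 closed strings on level $k$ are denoted $\binom{k}{1},\binom{k}{2},\dots$ from left to right. Let $I$ be the set of all closed strings. A closed string on level $j$ whose end nodes lie in the $p$-th and $q$-th triangles ($p<q$) intersects the $r$-th triangle if and only if $p\le r\le q$. **Exchange matrix.** The exchange matrix of $T$ is the skew-symmetrizable integer matrix $B=(b_{xy})_{x,y\in I}=\sum_m B^{(m)}$, the sum over all nodes $m$, where $B^{(m)}=(b^{(m)}_{xy})_{x,y\in I}$ is as follows. Let $m$ lie on level $k$, let $\epsilon(m)=1$ if $m$ is labeled $k$ and $\epsilon(m)=-1$ if it is labeled $-k$, and let $x$ and $y$ be the strings on level $k$ immediately to the left and to the right of $m$. - If $x$ and $y$ are both closed, $b^{(m)}_{xy}=-b^{(m)}_{yx}=\epsilon(m)$. - For each closed string $z$ on a level $j\ne k$ that intersects the triangle containing $m$: if $x$ is closed, $b^{(m)}_{xz}=\frac{a_{kj}}2\epsilon(m)$ and $b^{(m)}_{zx}=-\frac{a_{jk}}2\epsilon(m)$; if $y$ is closed, $b^{(m)}_{yz}=-\frac{a_{kj}}2\epsilon(m)$ and $b^{(m)}_{zy}=\frac{a_{jk}}2\epsilon(m)$. - All other entries of $B^{(m)}$ are $0$. *)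

(* Defs.v *)
From HB Require Import structures.
From mathcomp Require Import all_boot all_order all_algebra.
From mathcomp Require Import zify ring.

Set Implicit Arguments.
Unset Strict Implicit.
Unset Printing Implicit Defensive.

Import Order.TTheory GRing.Theory Num.Theory.

Local Open Scope ring_scope.

Definition symmetrizable_gcm (n : nat) (A : 'M[int]_n) : Prop :=
  [/\ forall i, A i i = 2,
      forall i j, i != j -> A i j <= 0,
      forall i j, A i j = 0 <-> A j i = 0
    & exists s : 'rV[int]_n,
        (forall i, 0 < s 0 i) /\ (diag_mx s *m A)^T = diag_mx s *m A].

(* Integer matrices indexed by an arbitrary finite set; finite functions make
   equality of matrices extensional. *)
Definition imatrix (I : finType) : Type := {ffun I -> {ffun I -> int}}.

Definition skew_symmetrizable (I : finType) (B : imatrix I) : Prop :=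
  exists s : I -> int,
    (forall i, 0 < s i) /\ (forall i j, s i * B i j = - (s j * B j i)).

Definition mutation (I : finType) (k : I) (B : imatrix I) : imatrix I :=
  [ffun i => [ffun j =>
    if (i == k) || (j == k) then - B i j
    else B i j + sgz (B i k) * Num.max (B i k * B k j) 0]].

(* The bijection h presents J as the disjoint union of I and {v}, v = h None. *)
Definition source_sink_extension (I J : finType) (h : option I -> J)
    (B : imatrix I) (C : imatrix J) : Prop :=
  let v := h None in
  [/\ bijective h,
      skew_symmetrizable C,
      forall i j : I, C (h (Some i)) (h (Some j)) = B i j,
      C v v = 0
    & (forall i : I, 0 <= C (h (Some i)) v) \/
      (forall i : I, C (h (Some i)) v <= 0)].

Inductive Pprime : forall I : finType, imatrix I -> Prop :=
| Pprime_empty (I : finType) (B : imatrix I) :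
    #|I| = 0%N -> Pprime B
| Pprime_zero (I : finType) (B : imatrix I) :
    #|I| = 1%N -> (forall i j, B i j = 0) -> Pprime B
| Pprime_mutation (I : finType) (k : I) (B : imatrix I) :
    Pprime B -> Pprime (mutation k B)
| Pprime_extension (I J : finType) (h : option I -> J)
    (B : imatrix I) (C : imatrix J) :
    Pprime B -> source_sink_extension h B C -> Pprime C.

(* A triangulation is recorded as the left-to-right list of its triangles:
   (true, k) is a triangle with a bottom edge labeled k (node k), and
   (false, k) a triangle with a top edge labeled k (node -k).  Levels and
   labels range over 'I_n, i.e., {1, ..., n} shifted by one. *)
Definition is_triangulation (n : nat) (i j : seq 'I_n)
    (T : seq (bool * 'I_n)) : Prop :=
  [seq t.2 | t <- T & ~~ t.1] = i /\ [seq t.2 | t <- T & t.1] = j.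

(* Nodes are identified with the positions of the triangles containing them. *)
Definition node_level (n : nat) (T : seq (bool * 'I_n)) (m : 'I_(size T)) :
  'I_n := (tnth (in_tuple T) m).2.

Definition node_sign (n : nat) (T : seq (bool * 'I_n)) (m : 'I_(size T)) :
  rat := if (tnth (in_tuple T) m).1 then 1 else -1.

(* A closed string is given by its two end nodes. *)
Definition is_closed_string (n : nat) (T : seq (bool * 'I_n))
    (x : 'I_(size T) * 'I_(size T)) : bool :=
  [&& (x.1 < x.2)%N, node_level x.1 == node_level x.2 &
    [forall m : 'I_(size T),
      (x.1 < m < x.2)%N ==> (node_level m != node_level x.1)]].

Definition closed_string (n : nat) (T : seq (bool * 'I_n)) : finType :=
  {x : 'I_(size T) * 'I_(size T) | is_closed_string x}.

Definition left_end (n : nat) (T : seq (bool * 'I_n)) (x : closed_string T) :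
  'I_(size T) := (val x).1.

Definition right_end (n : nat) (T : seq (bool * 'I_n)) (x : closed_string T) :
  'I_(size T) := (val x).2.

Definition string_level (n : nat) (T : seq (bool * 'I_n))
  (x : closed_string T) : 'I_n := node_level (left_end x).

Definition intersects (n : nat) (T : seq (bool * 'I_n))
    (x : closed_string T) (r : 'I_(size T)) : bool :=
  (left_end x <= r <= right_end x)%N.

(* x is the string immediately to the left of the node m. *)
Definition left_of (n : nat) (T : seq (bool * 'I_n))
  (x : closed_string T) (m : 'I_(size T)) : bool := right_end x == m.

(* x is the string immediately to the right of the node m. *)
Definition right_of (n : nat) (T : seq (bool * 'I_n))
  (x : closed_string T) (m : 'I_(size T)) : bool := left_end x == m.

Definition crosses (n : nat) (T : seq (bool * 'I_n))
    (z : closed_string T) (m : 'I_(size T)) : bool :=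
  (string_level z != node_level m) && intersects z m.

(* The entry of B^(m) at (u, w); it may be a half-integer. *)
Definition node_entry (n : nat) (A : 'M[int]_n) (T : seq (bool * 'I_n))
    (m : 'I_(size T)) (u w : closed_string T) : rat :=
  let k := node_level m in
  let e := node_sign m in
  if left_of u m && right_of w m then e
  else if right_of u m && left_of w m then - e
  else if left_of u m && crosses w m then (A k (string_level w))%:~R / 2 * e
  else if crosses u m && left_of w m then
    - ((A (string_level u) k)%:~R / 2 * e)
  else if right_of u m && crosses w m then
    - ((A k (string_level w))%:~R / 2 * e)
  else if crosses u m && right_of w m then (A (string_level u) k)%:~R / 2 * e
  else 0.

(* The floor only casts the sum, which is an integer by exchange_matrixE. *)
Definition exchange_matrix (n : nat) (A : 'M[int]_n) (T : seq (bool * 'I_n)) :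
    imatrix (closed_string T) :=
  [ffun x => [ffun y => Num.floor (\sum_m node_entry A m x y)]].

Lemma right_end_level (n : nat) (T : seq (bool * 'I_n)) (x : closed_string T) :
  node_level (right_end x) = string_level x.
Proof. by have /and3P[_ /eqP<- _] := valP x. Qed.

Lemma node_entry_same_level (n : nat) (A : 'M[int]_n) (T : seq (bool * 'I_n))
    (m : 'I_(size T)) (u w : closed_string T) :
  string_level u = string_level w -> node_entry A m u w \is a Num.int.
Proof.
move=> uw; rewrite /node_entry.
have e_int : node_sign m \is a Num.int by rewrite /node_sign; case: ifP.
have lvl (x : closed_string T) : left_of x m || right_of x m ->
    node_level m = string_level x.
  by case/orP => /eqP <-; rewrite ?right_end_level.
have ncr (x z : closed_string T) : string_level x = string_level z ->
    left_of x m || right_of x m -> crosses z m = false.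
  by move=> xz /lvl mx; rewrite /crosses mx xz eqxx.
have {ncr lvl} [cw cu] : ((left_of u m || right_of u m) && crosses w m = false)
    /\ ((left_of w m || right_of w m) && crosses u m = false).
  split; apply/negbTE/negP => /andP[+ cr].
    by move=> /(ncr _ _ uw); rewrite cr.
  by move=> /(ncr _ _ (esym uw)); rewrite cr.
move: cw cu; case: (left_of u m); case: (right_of u m); case: (left_of w m);
  case: (right_of w m); case: (crosses w m); case: (crosses u m) => //= _ _;
  by rewrite ?rpredN.
Qed.

Lemma node_entry_diff_level (n : nat) (A : 'M[int]_n) (T : seq (bool * 'I_n))
    (m : 'I_(size T)) (u w : closed_string T) :
  string_level u != string_level w ->
  node_entry A m u w =
  (A (string_level u) (string_level w))%:~R / 2 *
  (node_sign m * ((right_end u == m)%:R - (left_end u == m)%:R)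
     * (intersects w m)%:R -
   node_sign m * ((right_end w == m)%:R - (left_end w == m)%:R)
     * (intersects u m)%:R).
Proof.
move=> uw; rewrite /node_entry.
have lvl (x : closed_string T) : left_of x m || right_of x m ->
    node_level m = string_level x.
  by case/orP => /eqP <-; rewrite ?right_end_level.
have end_neq (x : closed_string T) : left_of x m -> right_of x m = false.
  move=> /eqP <-; have /and3P[lt_x _ _] := valP x.
  by rewrite /right_of -val_eqE /= ltn_eqF.
rewrite -!/(left_of _ m) -!/(right_of _ m).
have [mu|nmu] := boolP (left_of u m || right_of u m).
  have mw : left_of w m || right_of w m = false.
    by apply/negP => /lvl; rewrite (lvl _ mu) => /eqP; rewrite (negPf uw).
  have -> : crosses w m = intersects w m.
    by rewrite /crosses (lvl _ mu) eq_sym uw.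
  have [/negPf lw /negPf rw] := norP (negbT mw).
  have := end_neq u; move: (mu); rewrite (lvl _ mu) lw rw !andbF.
  by case: (left_of u m) => /=; [move=> _ ->|move=> -> _] => //=;
    case: (intersects w m) => /=; ring.
have [/negPf lu /negPf ru] := norP nmu; rewrite lu ru /=.
have [mw|nmw] := boolP (left_of w m || right_of w m); last first.
  have [/negPf lw /negPf rw] := norP nmw.
  by rewrite lw rw !andbF; ring.
have -> : crosses u m = intersects u m by rewrite /crosses (lvl _ mw) uw.
have := end_neq w; move: (mw); rewrite (lvl _ mw).
by case: (left_of w m) => /=; [move=> _ ->|move=> -> _] => //=;
  case: (intersects u m) => /=; ring.
Qed.

Lemma exchange_matrixE (n : nat) (A : 'M[int]_n) (T : seq (bool * 'I_n))
    (x y : closed_string T) :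
  (exchange_matrix A T x y)%:~R = \sum_m node_entry A m x y.
Proof.
rewrite !ffunE; apply: floorK.
have [xy|xy] := eqVneq (string_level x) (string_level y).
  by apply: rpred_sum => m _; apply: node_entry_same_level.
under eq_bigr do rewrite node_entry_diff_level //.
rewrite -mulr_sumr sumrB.
have pick1 (F G : 'I_(size T) -> rat) (a : 'I_(size T)) :
    \sum_m F m * (a == m)%:R * G m = F a * G a.
  rewrite (bigD1 a) //= eqxx mulr1 big1 ?addr0 // => m.
  by rewrite eq_sym => /negPf->; rewrite mulr0 mul0r.
under eq_bigr do rewrite mulrBr mulrBl.
under [X in _ - X]eq_bigr do rewrite mulrBr mulrBl.
rewrite !sumrB !pick1.
have level_neq (a b : 'I_(size T)) : node_level a = string_level x ->
    node_level b = string_level y -> (a : nat) <> b.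
  move=> ax ey eab; have ab : a = b by exact: val_inj.
  by move: xy; rewrite -ax -ey ab eqxx.
have n1 := level_neq _ _ (right_end_level x) (right_end_level y).
have n2 := level_neq _ _ (erefl : node_level (left_end x) = _) (right_end_level y).
have n3 := level_neq _ _ (right_end_level x) (erefl : node_level (left_end y) = _).
have n4 := level_neq _ _ (erefl : node_level (left_end x) = _)
  (erefl : node_level (left_end y) = _).
have ltx : (left_end x < right_end x)%N by have /and3P[] := valP x.
have lty : (left_end y < right_end y)%N by have /and3P[] := valP y.
pose sg (m : 'I_(size T)) : int := if (tnth (in_tuple T) m).1 then 1 else -1.
have sgE m : node_sign m = (sg m)%:~R by rewrite /sg /node_sign; case: ifP.
have sg1 m : sg m = 1 \/ sg m = -1 by rewrite /sg; case: ifP; [left|right].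
have [c Hc] : exists c : int,
    sg (right_end x) * (intersects y (right_end x))%:Z -
    sg (left_end x) * (intersects y (left_end x))%:Z -
    (sg (right_end y) * (intersects x (right_end y))%:Z -
     sg (left_end y) * (intersects x (left_end y))%:Z) = 2 * c.
{ rewrite /intersects.
  move: (sg1 (right_end x)) (sg1 (left_end x)) (sg1 (right_end y))
    (sg1 (left_end y)) n1 n2 n3 n4 ltx lty.
  move: (sg (right_end x)) (sg (left_end x)) (sg (right_end y))
    (sg (left_end y)) => s1 s2 s3 s4.
  move: (nat_of_ord (left_end x)) (nat_of_ord (right_end x))
    (nat_of_ord (left_end y)) (nat_of_ord (right_end y)) => a b c d.
  move=> h1 h2 h3 h4 n1 n2 n3 n4 lab lcd.
  case Eb: (c <= b <= d)%N; case Ea: (c <= a <= d)%N;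
    case Ed: (a <= d <= b)%N; case Ec: (a <= c <= b)%N;
    try (exfalso; lia).
  all: case: h1 => ->; case: h2 => ->; case: h3 => ->; case: h4 => ->.
  all: by [exists 0|exists 1|exists (-1)]. }
set lhs := (X in X \is a Num.int).
suff -> : lhs = (A (string_level x) (string_level y) * c)%:~R
  by exact: intr_int.
have {}Hc := congr1 (fun z : int => z%:~R : rat) Hc.
rewrite /= !(intrB, intrM) in Hc.
rewrite /lhs !sgE !pmulrn Hc intrM.
by field.
Qed.

(* Main.v *)
(** A closed string is determined by its level [k] and by the number [c] of
    nodes of level [k] up to its left end; labelled by [(k, c)], it crosses the
    gap after a prefix [P] of the word of nodes iff [P] has exactly [c] nodes of
    level [k].  With [S_x] the indicator of the gaps crossed by [x],
    [2 b_xy = a_xy * \sum_m eps(m) (S_x(m) S_y(m+1) - S_x(m+1) S_y(m))].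
    Swapping two adjacent nodes of opposite signs preserves this matrix when
    their levels differ and mutates it when they agree, and the sign of the last
    node is irrelevant; hence all nodes may be taken positive.  Let then [k] be
    the level of the last node, [y_1, ..., y_K] the closed strings on level [k],
    and [v = y_K]; deleting the last node deletes [v].  Mutating at [y_(K-1)],
    then [y_(K-2)], ..., then [y_1] makes [v] a source or a sink, so induction
    on the number of nodes applies. *)

Require Import Defs.
From mathcomp Require Import all_boot all_order all_algebra.
From mathcomp Require Import zify ring.

Set Implicit Arguments.
Unset Strict Implicit.
Unset Printing Implicit Defensive.

Import Order.TTheory GRing.Theory Num.Theory.

Local Open Scope ring_scope.

(** * Membership in [Pprime] for matrices indexed by lists of labels *)

Lemma Pprime_reindex (I J : finType) (h : I -> J) (B : imatrix I)
    (C : imatrix J) :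
  bijective h -> (forall i j, C (h i) (h j) = B i j) -> Pprime B -> Pprime C.
Proof.
move=> bij_h hC pB; elim: pB J h C bij_h hC => {I B}.
- move=> I B I0 J h C bij_h _; apply: Pprime_empty.
  by rewrite -(bij_eq_card bij_h).
- move=> I B I1 B0 J h C [h' hK h'K] hC.
  apply: Pprime_zero => [|i j].
    by rewrite -(bij_eq_card (Bijective hK h'K)).
  by rewrite -[i]h'K -[j]h'K hC.
- move=> I k B _ IH J h C [h' hK h'K] hC.
  pose C0 : imatrix J := [ffun x => [ffun y => B (h' x) (h' y)]].
  have -> : C = mutation (h k) C0.
    apply/ffunP => x; apply/ffunP => y.
    rewrite -[x]h'K -[y]h'K hC !ffunE !hK.
    by rewrite !(inj_eq (can_inj hK)).
  apply: Pprime_mutation; apply: (IH _ h) => [|i j]; first by exists h'.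
  by rewrite !ffunE !hK.
- move=> I J0 h0 B C0 pB _ [bij_h0 [s [s_gt0 sC]] hC0 C00 sgnC] J h C bij_h hC.
  have [h' hK h'K] := bij_h.
  apply: (Pprime_extension (h := h \o h0) pB); split=> /=.
  + exact: bij_comp.
  + exists (s \o h'); split=> [i|i j] /=; first exact: s_gt0.
    by rewrite -[i]h'K -[j]h'K !hC !hK.
  + by move=> i j; rewrite hC.
  + by rewrite hC.
  + by case: sgnC => sgnC; [left|right] => i; rewrite hC.
Qed.

(** Entries live on the whole label type, so matrices of words with different closed strings are
    compared without transport. *)
Definition restriction (L : choiceType) (s : seq L) (f : L -> L -> int) :
    imatrix (seq_sub s) :=
  [ffun x => [ffun y => f (ssval x) (ssval y)]].

Definition fmutation (L : eqType) (k : L) (f : L -> L -> int) (i j : L) : int :=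
  if (i == k) || (j == k) then - f i j
  else f i j + sgz (f i k) * Num.max (f i k * f k j) 0.

(** The product b_ik b_kj survives the first mutation while b_ik changes sign, so the two
    corrections cancel. *)
Lemma fmutationK (L : eqType) (k : L) (f : L -> L -> int) (i j : L) :
  fmutation k (fmutation k f) i j = f i j.
Proof.
rewrite /fmutation eqxx orbT /=; have [->|ik] := eqVneq i k.
  by rewrite opprK.
have [->|jk] /= := eqVneq j k; first by rewrite opprK.
by rewrite mulrNN sgzN; ring.
Qed.

Definition fskew (L : eqType) (s : seq L) (d : L -> int) (f : L -> L -> int) :=
  {in s &, forall i j, d i * f i j = - (d j * f j i)}.

(** After scaling, both corrections are multiples of max(- d_k b_ki b_kj, 0); when this is positive,
    b_ki and b_kj have opposite signs. *)
Lemma fmutation_skew (L : eqType) (s : seq L) (d : L -> int)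
    (f : L -> L -> int) (k : L) :
  (forall i, 0 < d i) -> k \in s -> fskew s d f -> fskew s d (fmutation k f).
Proof.
move=> d_gt0 ks fs i j si sj; rewrite /fmutation orbC.
have ij := fs i j si sj.
case: ifP => _; first by rewrite !mulrN ij.
have := fs i k si ks; have := fs j k sj ks.
rewrite !mulrDr ij opprD; move: (d_gt0 i) (d_gt0 j) (d_gt0 k).
move: (f i k) (f k i) (f j k) (f k j) (d i) (d j) (d k) => a a' b b' x y z.
move=> x0 y0 z0 eb ea; congr (_ + _).
have sg (p c c' : int) : 0 < p -> p * c = - (z * c') -> sgz c = - sgz c'.
  move=> /gtr0_sgz p1 /(congr1 (@sgz int)).
  by rewrite sgzN !sgzM p1 (gtr0_sgz z0) !mul1r.
rewrite (sg _ _ _ x0 ea) (sg _ _ _ y0 eb) !mulNr !mulrN opprK.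
rewrite [x * _]mulrCA [y * _]mulrCA.
rewrite (maxr_pMr (a * b') 0 (ltW x0)) (maxr_pMr (b * a') 0 (ltW y0)).
rewrite !mulr0 !mulrA ea eb.
rewrite !mulNr -!mulrA [b' * a']mulrC.
have [ab|ab] := lerP (- (z * (a' * b'))) 0; first by rewrite !mulr0 oppr0.
rewrite -mulNr; congr (_ * _).
move: ab; rewrite oppr_gt0 pmulr_rlt0 //.
by have [->|a0|a0] := sgzP a'; have [->|b0|b0] := sgzP b' => //; nia.
Qed.

Lemma restriction_eq (L : choiceType) (s t : seq L) (f g : L -> L -> int) :
  s =i t -> {in t &, forall i j, f i j = g i j} ->
  Pprime (restriction s f) -> Pprime (restriction t g).
Proof.
move=> st fg.
have hst (x : seq_sub s) : ssval x \in t by rewrite -st; apply: ssvalP.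
have hts (x : seq_sub t) : ssval x \in s by rewrite st; apply: ssvalP.
apply: (@Pprime_reindex _ _ (fun x : seq_sub s => SeqSub (hst x))).
  by exists (fun x : seq_sub t => SeqSub (hts x)) => x; apply: val_inj.
by move=> i j; rewrite !ffunE /= fg.
Qed.

Lemma restriction_mutation (L : choiceType) (s : seq L) (f : L -> L -> int)
    (k : L) :
  k \in s -> Pprime (restriction s f) -> Pprime (restriction s (fmutation k f)).
Proof.
move=> ks pf; have := Pprime_mutation (SeqSub ks) pf.
congr (Pprime _); apply/ffunP => i; apply/ffunP => j.
by rewrite !ffunE /fmutation -!val_eqE /=.
Qed.

Lemma restriction_extension (L : choiceType) (s : seq L) (f : L -> L -> int)
    (d : L -> int) (v : L) :
  v \notin s -> (forall i, 0 < d i) -> fskew (v :: s) d f ->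
  {in s, forall i, f i v <= 0} ->
  Pprime (restriction s f) -> Pprime (restriction (v :: s) f).
Proof.
move=> vs d_gt0 fs fv pf.
have hs (x : seq_sub s) : ssval x \in v :: s by rewrite inE (ssvalP x) orbT.
pose h (o : option (seq_sub s)) : seq_sub (v :: s) :=
  if o is Some x then SeqSub (hs x) else SeqSub (mem_head v s).
apply: (Pprime_extension (h := h) pf); split.
- exists (fun y => insub (ssval y)) => [[x|] | [y ys]] /=.
  + by rewrite valK.
  + by rewrite insubN.
  + case: insubP => [x _ xy|]; first by apply: val_inj.
    by have := ys; rewrite inE => /orP[/eqP yv _|->//]; apply: val_inj.
- exists (fun i => d (ssval i)); split=> [i|i j] /=; first exact: d_gt0.
  by rewrite !ffunE; apply: fs; apply: ssvalP.
- by move=> i j; rewrite !ffunE.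
- rewrite ffunE ffunE /=; have := fs _ _ (mem_head v s) (mem_head v s).
  by have := d_gt0 v; nia.
- by right=> i; rewrite !ffunE /=; apply: fv; apply: ssvalP.
Qed.

(** * Labels of closed strings, the pairing and its integrality *)

Definition nodes_on (n : nat) (k : 'I_n) (R : seq (bool * 'I_n)) : nat :=
  count (fun t => t.2 == k) R.

(* [(k, c)] labels the string of level [k] joining its [c]-th and [c+1]-st
   nodes. *)
Definition closed_labels (n : nat) (R : seq (bool * 'I_n)) :
    seq ('I_n * nat) :=
  [seq (k, c) | k <- enum 'I_n, c <- iota 1 (nodes_on k R).-1].

(* Whether the string [x] crosses the right end of the prefix [R], where
   prefixes are written from right to left. *)
Definition active (n : nat) (x : 'I_n * nat) (R : seq (bool * 'I_n)) : int :=
  (nodes_on x.1 R == x.2)%:R.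

Definition sign_of (b : bool) : int := if b then 1 else -1.

(** A 2-by-2 determinant, formed by the activities of [x] and [y] before and after a node. *)
Definition cross (n : nat) (R R' : seq (bool * 'I_n)) (x y : 'I_n * nat) : int :=
  active x R * active y R' - active x R' * active y R.

Fixpoint pairing (n : nat) (R : seq (bool * 'I_n)) (x y : 'I_n * nat) : int :=
  if R is t :: R' then
    pairing R' x y + sign_of t.1 * cross R' R x y
  else 0.

(** The division is exact on closed labels when all a_ii are 2, by [entryE]. *)
Definition entry (n : nat) (A : 'M[int]_n) (R : seq (bool * 'I_n))
    (x y : 'I_n * nat) : int :=
  (A x.1 y.1 * pairing R x y %/ 2)%Z.

Definition in_Pprime (n : nat) (A : 'M[int]_n) (R : seq (bool * 'I_n)) : Prop :=
  Pprime (restriction (closed_labels R) (entry A R)).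

Lemma mem_closed_labels (n : nat) (R : seq (bool * 'I_n)) (x : 'I_n * nat) :
  (x \in closed_labels R) = (0 < x.2 < nodes_on x.1 R)%N.
Proof.
case: x => k c; apply/allpairsPdep/idP => [[k' [c' [_ + [-> ->]]]]|lt_c] /=.
  by rewrite mem_iota; lia.
by exists k, c; rewrite mem_enum mem_iota; split=> //; move: lt_c => /=; lia.
Qed.

Lemma pairing_skew (n : nat) (R : seq (bool * 'I_n)) (x y : 'I_n * nat) :
  pairing R x y = - pairing R y x.
Proof. by elim: R => [|t R IH] //=; rewrite IH /cross; ring. Qed.

Lemma active_cons (n : nat) (t : bool * 'I_n) (R : seq (bool * 'I_n))
    (x : 'I_n * nat) :
  t.2 != x.1 -> active x (t :: R) = active x R.
Proof. by rewrite /active /nodes_on /= => /negPf ->. Qed.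

Lemma active_bool (n : nat) (x : 'I_n * nat) (R : seq (bool * 'I_n)) :
  active x R = 0 \/ active x R = 1.
Proof. by rewrite /active; case: eqP; [right|left]. Qed.

Lemma active_closed (n : nat) (x : 'I_n * nat) (R : seq (bool * 'I_n)) :
  x \in closed_labels R -> active x R = 0.
Proof.
by rewrite mem_closed_labels /active => /andP[_ lt_x]; rewrite gtn_eqF.
Qed.

(* Modulo 2 each node contributes the variation of [active x * active y]. *)
Lemma pairing_parity (n : nat) (R : seq (bool * 'I_n)) (x y : 'I_n * nat) :
  x.1 != y.1 -> (0 < x.2)%N ->
  exists c, pairing R x y = active x R * active y R + 2 * c.
Proof.
move=> xy x0; elim: R => [|t R [c IH]] /=.
  by exists 0; rewrite /active /nodes_on /= ltn_eqF // mul0r.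
rewrite IH /cross; have [tx|tx] := eqVneq t.2 x.1.
  rewrite (@active_cons _ t R y) ?tx //.
  have [-> | ->] := active_bool x R; have [-> | ->] := active_bool y R;
    have [-> | ->] := active_bool x (t :: R); case: t.1; rewrite /sign_of;
    by [exists c | exists (c + 1) | exists (c - 1); ring | exists (c + 1); ring
       | exists c; ring].
rewrite (@active_cons _ t R x) //.
  have [-> | ->] := active_bool x R; have [-> | ->] := active_bool y R;
    have [-> | ->] := active_bool y (t :: R); case: t.1; rewrite /sign_of;
    by [exists c | exists (c + 1) | exists (c - 1); ring | exists (c + 1); ring
       | exists c; ring].
Qed.

(** On one level the Cartan entry is 2; on distinct levels the pairing is even by [pairing_parity],
    since a closed string is inactive at the end of the word. *)
Lemma entryE (n : nat) (A : 'M[int]_n) (R : seq (bool * 'I_n)) :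
  (forall i, A i i = 2) ->
  {in closed_labels R &, forall x y,
    2 * entry A R x y = A x.1 y.1 * pairing R x y}.
Proof.
move=> A2 x y xR yR; rewrite mulrC; apply: divzK.
have [->|xy] := eqVneq x.1 y.1; first by rewrite A2 dvdz_mulr.
have [|c ->] := pairing_parity R xy.
  by move: xR; rewrite mem_closed_labels => /andP[].
by rewrite active_closed // mul0r add0r mulrCA dvdz_mulr.
Qed.

Lemma entry_skew (n : nat) (A : 'M[int]_n) (R : seq (bool * 'I_n))
    (d : 'I_n -> int) :
  (forall i, A i i = 2) -> (forall i j, d i * A i j = d j * A j i) ->
  fskew (closed_labels R) (fun x => d x.1) (entry A R).
Proof.
move=> A2 dA x y xR yR.
have := entryE A2 xR yR; have := entryE A2 yR xR.
rewrite [pairing R y x]pairing_skew => eyx exy.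
have := congr1 (fun z => z * pairing R x y) (dA x.1 y.1).
rewrite -!mulrA -exy; have -> : A y.1 x.1 * pairing R x y = - (2 * entry A R y x).
  by rewrite eyx mulrN opprK.
by lia.
Qed.

(** * Swaps of adjacent nodes and reduction to positive words *)

Lemma pairing_before (n : nat) (R : seq (bool * 'I_n)) (x y : 'I_n * nat) :
  (nodes_on y.1 R < y.2)%N -> pairing R x y = 0.
Proof.
elim: R => [//|t R IH] /= lt_y.
have ltR : (nodes_on y.1 R < y.2)%N by apply: leq_ltn_trans lt_y; exact: leq_addl.
rewrite IH // /cross /active (ltn_eqF lt_y) (ltn_eqF ltR) /=.
by rewrite !mulr0.
Qed.

(** With [pairing_before], this confines the pairing with [y] to the nodes from the left end of [y]
    to its right end: [y] is inactive elsewhere. *)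
Lemma pairing_after (n : nat) (P R : seq (bool * 'I_n)) (x y : 'I_n * nat) :
  (y.2 < nodes_on y.1 R)%N -> pairing (P ++ R) x y = pairing R x y.
Proof.
move=> lt_y; elim: P => [//|t P IH] /=.
have ltP (Q : seq (bool * 'I_n)) : (y.2 < nodes_on y.1 (Q ++ R))%N.
  by rewrite /nodes_on count_cat ltn_addl.
rewrite IH /cross /active (gtn_eqF (ltP P)) (gtn_eqF (ltP (t :: P))).
by rewrite !mulr0 addr0.
Qed.

Lemma pairing_cat (n : nat) (P R R' : seq (bool * 'I_n)) (x y : 'I_n * nat) :
  (forall k, nodes_on k R = nodes_on k R') ->
  pairing (P ++ R) x y - pairing R x y = pairing (P ++ R') x y - pairing R' x y.
Proof.
move=> RR'; elim: P => [|t P IH] /=; first by rewrite !subrr.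
have act z Q : active z (Q ++ R) = active z (Q ++ R').
  by rewrite /active /nodes_on !count_cat -![count _ R]/(nodes_on _ _) RR'.
rewrite /cross -!cat_cons !act.
by rewrite addrAC IH addrAC.
Qed.

Lemma closed_labels_eq (n : nat) (R R' : seq (bool * 'I_n)) :
  (forall k, nodes_on k R = nodes_on k R') -> closed_labels R =i closed_labels R'.
Proof. by move=> RR' x; rewrite !mem_closed_labels RR'. Qed.

Lemma nodes_on_swap (n : nat) (k : 'I_n) (P R : seq (bool * 'I_n))
    (t u : bool * 'I_n) :
  nodes_on k (P ++ t :: u :: R) = nodes_on k (P ++ u :: t :: R).
Proof. by rewrite /nodes_on !count_cat /=; congr (_ + _)%N; apply: addnCA. Qed.

(** Let the activity vector v of [x] and [y] move by p at one node and by q at the other,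
    independently of the order since the levels differ. With opposite signs both orders contribute
    the same: det(v, q) - det(v + q, p) = det(v + p, q) - det(v, p). *)
Lemma pairing_swap (n : nat) (P R : seq (bool * 'I_n)) (t u : bool * 'I_n)
    (x y : 'I_n * nat) :
  u.1 = ~~ t.1 -> t.2 != u.2 ->
  pairing (P ++ t :: u :: R) x y = pairing (P ++ u :: t :: R) x y.
Proof.
move=> ut tu; have sw k : nodes_on k (t :: u :: R) = nodes_on k (u :: t :: R).
  exact: (@nodes_on_swap _ k [::]).
have /eqP := pairing_cat P x y sw; rewrite subr_eq => /eqP ->.
suff -> : pairing (t :: u :: R) x y = pairing (u :: t :: R) x y by rewrite subrK.
rewrite /= /cross /active /nodes_on /= ut.
have tu_excl z : (t.2 == z) = false \/ (u.2 == z) = false.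
  by case: eqVneq => [<-|_]; [right; rewrite eq_sym (negPf tu)|left].
by have [->|->] := tu_excl x.1; have [->|->] := tu_excl y.1; rewrite !add0n;
  case: t.1; rewrite /sign_of /=; ring.
Qed.

(* Flipping the diagonal between two nodes of opposite signs on one level
   mutates at the closed string joining them. *)
Lemma entry_flip (n : nat) (A : 'M[int]_n) (P R : seq (bool * 'I_n))
    (b : bool) (k : 'I_n) :
  (forall i, A i i = 2) -> (forall i j, i != j -> A i j <= 0) ->
  let Q := P ++ (b, k) :: (~~ b, k) :: R in
  {in closed_labels Q &, forall x y,
    entry A (P ++ (~~ b, k) :: (b, k) :: R) x y =
    fmutation (k, (nodes_on k R).+1) (entry A Q) x y}.
Proof.
have sb : sign_of b = 1 \/ sign_of b = -1 by case: b; [left|right].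
have sbN : sign_of (~~ b) = - sign_of b by case: b {sb}.
move=> A2 A0 Q x y xQ yQ; set Q' := P ++ _; set v := (k, _).
have QQ' : closed_labels Q =i closed_labels Q'.
  by apply: closed_labels_eq => l; apply: nodes_on_swap.
(* [act1] is the activity in the gap between the two nodes, [act2] the sum of those in the gaps
   before and after the pair. *)
pose act2 (z : 'I_n * nat) := active z R + active z ((b, k) :: (b, k) :: R).
pose act1 (z : 'I_n * nat) := active z ((b, k) :: R).
have vQ : v \in closed_labels Q.
  by rewrite mem_closed_labels /v /nodes_on count_cat /= eqxx; lia.
(* Only the two ends of [v] contribute, since [v] is active just in the gap between them. *)
have Dv z : pairing Q z v = - sign_of b * act2 z.
  rewrite pairing_after; last by rewrite /nodes_on /= eqxx.
  rewrite /= pairing_before /=; last by [].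
  rewrite /cross /act2 /active /v /nodes_on /= !eqxx /= !add1n.
  by rewrite (ltn_eqF (ltnSn _)) (gtn_eqF (ltnSn _)) sbN /=; ring.
have DQ : pairing Q' x y =
    pairing Q x y + 2 * sign_of b * (act2 x * act1 y - act1 x * act2 y).
  have := @pairing_cat _ P ((b, k) :: (~~ b, k) :: R) ((~~ b, k) :: (b, k) :: R) x y.
  rewrite -/Q -/Q' => /(_ (fun l => erefl)) /eqP.
  rewrite eq_sym subr_eq => /eqP ->.
  rewrite /= /cross /act1 /act2 /active /nodes_on /=.
  by rewrite sbN; ring.
have xQ' : x \in closed_labels Q' by rewrite -QQ'.
have yQ' : y \in closed_labels Q' by rewrite -QQ'.
have := entryE A2 xQ' yQ'; have := entryE A2 xQ yQ.
have := entryE A2 xQ vQ; have := entryE A2 vQ yQ.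
rewrite [pairing Q v y]pairing_skew !Dv DQ /=.
(* On level [k] only [v] is active in the middle gap, and any other string on at most one side of
   the pair; off level [k] the activity is constant. *)
have lvl z : (z.1 = k /\ (z = v /\ act1 z = 1 /\ act2 z = 0 \/
     z <> v /\ act1 z = 0 /\ (act2 z = 0 \/ act2 z = 1))) \/
   (z.1 <> k /\ z <> v /\ (act1 z = 0 /\ act2 z = 0 \/ act1 z = 1 /\ act2 z = 2)).
  case: z => l c; rewrite /act1 /act2 /active /nodes_on /v /=.
  have [->|lk] := eqVneq l k.
    left; split=> //; rewrite !add1n -/(nodes_on k R).
    have [->|cv] := eqVneq c (nodes_on k R).+1.
      by left; rewrite (ltn_eqF (ltnSn _)) (gtn_eqF (ltnSn _)).
    right; split; first by case=> /eqP; rewrite (negPf cv).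
    split=> //.
    have [->|_] := eqVneq (nodes_on k R) c.
      by rewrite gtn_eqF //; right; rewrite ?addr0.
    by case: eqP; [right|left].
  right; split; first exact/eqP.
  split; first by case=> /eqP; rewrite (negPf lk).
  by rewrite !add0n; case: eqP; [right|left].
move=> Evy Exv Exy Exy'; rewrite /fmutation.
have [xv|/eqP xv] := eqVneq x v.
  move: Exy Exy' (lvl x); rewrite xv /= [pairing Q v y]pairing_skew Dv.
  by move=> Exy Exy' [[_ [[_ [x1 x2]]|[]//]]|[]//]; move: Exy'; rewrite x1 x2; nia.
have [yv|/eqP yv] /= := eqVneq y v.
  move: Exy Exy' (lvl y); rewrite yv /= Dv.
  by move=> Exy Exy' [[_ [[_ [x1 x2]]|[]//]]|[]//]; move: Exy'; rewrite x1 x2; nia.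
move: Evy Exv Exy Exy'; move: (entry A Q v y) (entry A Q x v) (entry A Q x y).
move: (entry A Q' x y) (pairing Q x y) => e' D f g e Ef Eg Ee Ee'.
(* With both labels on level [k], or both off it, b_xv b_vy <= 0 and the entry is unchanged. With
   exactly one on it, a nonpositive Cartan entry makes this product nonnegative, and the correction
   accounts for the change of the pairing. *)
have := lvl x; have := lvl y.
case=> [[yk [[//]|[_ [y1 y2]]]]|[yk [_ y12]]];
case=> [[xk [[//]|[_ [x1 x2]]]]|[xk [_ x12]]].
- have -> : e' = e by move: Ee'; rewrite x1 y1; nia.
  rewrite max_r ?mulr0 ?addr0 //.
  move: Ef Eg; rewrite xk yk A2.
  by case: x2 => ->; case: y2 => ->; case: sb => ->; nia.
- have := A0 x.1 k (introN eqP xk); move: Ef Eg Ee Ee'; rewrite yk A2 y1.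
  move: (A x.1 k) => a.
  by case: x12 => [] [-> ->]; case: y2 => ->; case: sb => ->; move=> Ef Eg Ee Ee' a0;
    have [h|h] := lerP (g * f) 0; have [g0|g0|g0] := sgzP g; nia.
- have := A0 k y.1 (introN eqP (nesym yk)); move: Ef Eg Ee Ee'; rewrite xk A2 x1.
  move: (A k y.1) => a.
  by case: y12 => [] [-> ->]; case: x2 => ->; case: sb => ->; move=> Ef Eg Ee Ee' a0;
    have [h|h] := lerP (g * f) 0; have [g0|g0|g0] := sgzP g; nia.
- have ax := A0 x.1 k (introN eqP xk).
  have ay := A0 k y.1 (introN eqP (nesym yk)).
  have -> : e' = e.
    by move: Ee'; case: x12 => [] [-> ->]; case: y12 => [] [-> ->]; nia.
  rewrite max_r ?mulr0 ?addr0 //.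
  move: Ef Eg ax ay; move: (A x.1 k) (A k y.1) => a c.
  by case: x12 => [] [_ ->]; case: y12 => [] [_ ->]; case: sb => ->; nia.
Qed.

Lemma in_Pprime_eq (n : nat) (A : 'M[int]_n) (R R' : seq (bool * 'I_n)) :
  (forall k, nodes_on k R = nodes_on k R') ->
  {in closed_labels R' &, pairing R =2 pairing R'} ->
  in_Pprime A R -> in_Pprime A R'.
Proof.
move=> RR' pRR'; apply: restriction_eq; first exact: closed_labels_eq.
by move=> x y xR yR; rewrite /entry pRR'.
Qed.

Lemma in_Pprime_swap (n : nat) (A : 'M[int]_n) (P R : seq (bool * 'I_n))
    (t u : bool * 'I_n) :
  (forall i, A i i = 2) -> (forall i j, i != j -> A i j <= 0) ->
  u.1 = ~~ t.1 -> in_Pprime A (P ++ t :: u :: R) ->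
  in_Pprime A (P ++ u :: t :: R).
Proof.
move=> A2 A0; have [|tu] := eqVneq t.2 u.2; last first.
  move=> ut; apply: in_Pprime_eq => [k|x y _ _]; first exact: nodes_on_swap.
  exact: pairing_swap.
case: t u => b k [b' k'] /= <- -> pB.
have vQ : (k, (nodes_on k R).+1) \in closed_labels (P ++ (b, k) :: (~~ b, k) :: R).
  by rewrite mem_closed_labels /nodes_on count_cat /= eqxx; lia.
apply: restriction_eq (restriction_mutation vQ pB).
  by apply: closed_labels_eq => l; apply: nodes_on_swap.
move=> x y.
rewrite -!(closed_labels_eq (fun l => nodes_on_swap l P R (b, k) (~~ b, k))).
by move=> xQ yQ; rewrite entry_flip.
Qed.

(** The head is the last node, after which no closed string is active, so its term in the pairing
    vanishes. *)
Lemma in_Pprime_head (n : nat) (A : 'M[int]_n) (R : seq (bool * 'I_n))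
    (b b' : bool) (k : 'I_n) :
  in_Pprime A ((b, k) :: R) -> in_Pprime A ((b', k) :: R).
Proof.
apply: in_Pprime_eq => // x y xR yR /=.
have c0 (c : bool) : cross R ((c, k) :: R) x y = 0.
  by rewrite /cross ![active _ ((c, k) :: R)]active_closed // mulr0 mul0r subrr.
by rewrite !c0 !mulr0.
Qed.

Lemma in_Pprime_move (n : nat) (A : 'M[int]_n) (S P R : seq (bool * 'I_n))
    (b : bool) (k : 'I_n) :
  (forall i, A i i = 2) -> (forall i j, i != j -> A i j <= 0) ->
  all (fun t => t.1 == ~~ b) P -> in_Pprime A (S ++ (b, k) :: P ++ R) ->
  in_Pprime A (S ++ P ++ (b, k) :: R).
Proof.
move=> A2 A0; elim: P S => [|t P IH] S //= /andP[/eqP tb Pb] pB.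
by rewrite -cat_rcons; apply: IH => //; rewrite cat_rcons; apply: in_Pprime_swap.
Qed.

(** Induction on the number of negative nodes: the one nearest to the head is moved there past
    positive nodes, and then its sign is changed. *)
Lemma in_Pprime_positive (n : nat) (A : 'M[int]_n) (R : seq (bool * 'I_n)) :
  (forall i, A i i = 2) -> (forall i j, i != j -> A i j <= 0) ->
  (forall R', size R' = size R -> all fst R' -> in_Pprime A R') ->
  in_Pprime A R.
Proof.
move=> A2 A0; have [m] := ubnP (count (fun t => ~~ t.1) R).
elim: m R => // m IH R; rewrite ltnS => le_m pos.
have [Rpos|] := boolP (all fst R); first exact: pos.
rewrite -has_predC => negR; move: le_m pos.
case/split_find: negR => -[[] k] // P R' _ /hasPn Ppos.
rewrite cat_rcons count_cat size_cat /= => le_m pos.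
apply: (in_Pprime_move (S := [::])) => //.
  by apply/allP => t /Ppos; rewrite /= negbK => ->.
apply: (in_Pprime_head (b := true)); apply: IH => [|R2 sR2]; last first.
  by apply: pos; rewrite sR2 /= size_cat addnS.
by rewrite /= count_cat; lia.
Qed.

(** * Mutations along a level and the extension by its last string *)

Fixpoint row_mutation (n : nat) (k : 'I_n) (K : nat)
    (F : 'I_n * nat -> 'I_n * nat -> int) (t : nat) :=
  if t is t'.+1 then fmutation (k, K - t)%N (row_mutation k K F t') else F.

(** The forward direction serves before the last string is adjoined, the backward one after it. *)
Lemma restriction_row_mutation (n : nat) (k : 'I_n) (K : nat)
    (F : 'I_n * nat -> 'I_n * nat -> int) (s : seq ('I_n * nat)) (t : nat) :
  (forall j, (0 < j < K)%N -> (k, j) \in s) -> (t < K)%N ->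
  Pprime (restriction s F) <-> Pprime (restriction s (row_mutation k K F t)).
Proof.
move=> ks; elim: t => // t IH lt_tK; rewrite IH /=; last exact: ltnW.
have ms : (k, K - t.+1)%N \in s by apply: ks; lia.
split; first exact: restriction_mutation.
move=> /(restriction_mutation ms); apply: restriction_eq => // x y _ _.
exact: fmutationK.
Qed.

Lemma row_mutation_skew (n : nat) (k : 'I_n) (K : nat) (d : 'I_n * nat -> int)
    (F : 'I_n * nat -> 'I_n * nat -> int) (s : seq ('I_n * nat)) (t : nat) :
  (forall i, 0 < d i) -> (forall j, (0 < j < K)%N -> (k, j) \in s) ->
  (t < K)%N -> fskew s d F -> fskew s d (row_mutation k K F t).
Proof.
move=> d0 ks lt_tK sF; elim: t lt_tK => // t IH lt_tK /=.
by apply: fmutation_skew => //; [apply: ks; lia | apply: IH; apply: ltnW].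
Qed.

(** This and [sgz_maxN] evaluate the correction of a mutation in a column whose entry in the mutated
    row is 1 or -1. *)
Lemma sgz_max (g : int) : sgz g * Num.max g 0 = Num.max g 0.
Proof. by case: sgzP => [->|g0|g0]; case: lerP => //; lia. Qed.

Lemma sgz_maxN (g : int) : sgz g * Num.max (- g) 0 = - Num.max (- g) 0.
Proof. by case: sgzP => [->|g0|g0]; case: lerP => //; lia. Qed.

(* The mutations at [(k, K - 1), ..., (k, 1)] turn the column of the last
   string [(k, K)] of level [k] into a nonpositive one.  For a string [z] on
   another level, [Z z i] tells whether [z] crosses the [i]-th node of level
   [k], counted from 0. *)
Lemma row_mutation_column (n : nat) (k : 'I_n) (K : nat)
    (F : 'I_n * nat -> 'I_n * nat -> int) (s : pred ('I_n * nat))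
    (a : 'I_n * nat -> int) (Z : 'I_n * nat -> nat -> bool) :
  (forall c e, (0 < c <= K)%N -> (0 < e <= K)%N ->
     F (k, c) (k, e) = (e == c.+1)%:R - (c == e.+1)%:R) ->
  (forall z j, s z -> (0 < j <= K)%N ->
     F z (k, j) = a z * ((Z z j.-1)%:R - (Z z j)%:R)) ->
  (forall z, s z -> z.1 != k) ->
  (forall z, s z -> a z <= 0) ->
  (forall z, s z -> Z z K = false) ->
  (forall z i j, s z -> (i <= j < K)%N -> Z z K.-1 -> Z z i -> Z z j) ->
  forall t j, (t + j.+1 = K)%N ->
  [/\ forall i x, (0 < i < j)%N ->
        (s x \/ exists2 c, x = (k, c) & (0 < c <= K)%N) ->
        row_mutation k K F t x (k, i) = F x (k, i),
      (0 < j)%N ->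
        (forall z, s z -> row_mutation k K F t z (k, j) =
           a z * ((Z z j.-1)%:R - (Z z j)%:R * (Z z K.-1)%:R)) /\
        (forall c, (0 < c <= K)%N -> row_mutation k K F t (k, c) (k, j) =
           (c.+1 == j)%:R + ((c == j.+1) && (j.+1 < K)%N)%:R - (c == K)%:R),
      forall z, s z -> row_mutation k K F t z (k, K) =
        a z * (Z z K.-1)%:R * (Z z j)%:R
    & forall c, (0 < c <= K)%N -> row_mutation k K F t (k, c) (k, K) =
        (c == j)%:R - ((c == j.+1) && (j.+1 < K)%N)%:R].
Proof.
(* After [t] mutations the next one is at [(k, j)], if [j] is positive. Lower columns are untouched,
   column [j] has been changed at most by the latest mutation, and column [K] is followed
   throughout. *)
move=> FK Fz sk a0 ZK Zmono; elim=> [|t IH] j tj.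
  move: FK Fz ZK {Zmono}; have {tj} -> : K = j.+1 by rewrite -tj.
  move=> FK Fz ZK; split=> //=.
  - move=> j0; split=> [z sz|c c0]; last by rewrite FK; lia.
    by rewrite Fz //; [case: (Z z j); rewrite /= ?mulr1 | lia].
  - move=> z sz; rewrite Fz ?leqnn //= ZK // subr0.
    by case: (Z z j); rewrite /= ?mulr1 ?mulr0.
  - by move=> c c0; rewrite FK //; lia.
have [|Ma /(_ isT) [Mbz Mbk] Mz Mk] := IH j.+1; first by lia.
have -> : row_mutation k K F t.+1 = fmutation (k, j.+1) (row_mutation k K F t).
  by rewrite /=; congr (fmutation (k, _) _); lia.
have jK : (0 < j.+1 <= K)%N by lia.
move: (row_mutation k K F t) Ma Mbz Mbk Mz Mk => M Ma Mbz Mbk Mz Mk.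
have eqk c e : ((k, c) == (k, e)) = (c == e) by rewrite xpair_eqE eqxx.
have eqz z c : s z -> (z == (k, c)) = false.
  by move=> /sk; apply: contraNF => /eqP ->.
(* In the other rows, with g the entry in column [(k, j.+1)], the mutation thus adds max(g, 0) to
   column [K] and, by [Myj] below, min(g, 0) to column [j]. *)
have Myv : M (k, j.+1) (k, K) = 1 by rewrite Mk; lia.
split.
- move=> i x ij sx; rewrite /fmutation eqk (ltn_eqF (_ : i < j.+1)%N) ?orbF; last by lia.
  have Myi : M (k, j.+1) (k, i) = 0.
    by rewrite Ma; [rewrite FK; lia | lia | right; exists j.+1].
  have [->|xj] := eqVneq x (k, j.+1).
    by rewrite Myi oppr0 -Myi Ma //; [lia | right; exists j.+1].
  by rewrite Myi mulr0 maxxx mulr0 addr0 Ma //; lia.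
- move=> j0; have Myj : M (k, j.+1) (k, j) = -1.
    by rewrite Ma; [rewrite FK; lia | lia | right; exists j.+1].
  split=> [z sz|c c0]; rewrite /fmutation !eqk (ltn_eqF (ltnSn j)) orbF.
    rewrite eqz // Myj mulrN1 sgz_maxN Ma; [|lia|by left].
    rewrite Fz // ?Mbz //; last by lia.
    have := Zmono z j j.+1 sz; have := a0 z sz.
    case: (Z z K.-1) => /= az Zj; rewrite ?mulr0 ?mul0r ?mulr1 ?subr0.
      (* Crossed nodes are consecutive: a string crossing nodes [j] and [K.-1] also crosses node
         [j.+1]. *)
      have {}Zj : ~~ (Z z j && ~~ Z z j.+1).
        by apply/negP => /andP[Zj1]; rewrite Zj //; lia.
      by case: (Z z j) Zj; case: (Z z j.+1) => //= _; case: lerP; nia.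
    by case: (Z z j) => /=; case: lerP; nia.
  have [->|cj] := eqVneq c j.+1; first by rewrite Myj; lia.
  rewrite Myj mulrN1 sgz_maxN Ma; [|lia|by right; exists c].
  rewrite FK // ?Mbk //; last by lia.
  by case: lerP; lia.
- move=> z sz; rewrite /fmutation eqz // eqk (gtn_eqF (_ : j.+1 < K)%N) /=; last by lia.
  rewrite Myv mulr1 sgz_max Mz // Mbz //.
  have := Zmono z j j.+1 sz; have := a0 z sz.
  case: (Z z K.-1) => /= az Zj; rewrite ?mulr0 ?mul0r ?mulr1 ?subr0.
    have {}Zj : ~~ (Z z j && ~~ Z z j.+1).
      by apply/negP => /andP[Zj1]; rewrite Zj //; lia.
    by case: (Z z j) Zj; case: (Z z j.+1) => //= _; case: lerP; nia.
  by case: (Z z j) => /=; case: lerP; nia.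
- move=> c c0; rewrite /fmutation !eqk (gtn_eqF (_ : j.+1 < K)%N) ?orbF /=; last by lia.
  have [->|cj] := eqVneq c j.+1; first by rewrite Myv; lia.
  by rewrite Myv mulr1 sgz_max Mk // Mbk //; case: lerP; lia.
Qed.

(* The number of nodes on level [l] before the [i]-th node on level [k], where
   [i] counts from 0; junk value 0 when there is no such node. *)
Fixpoint nodes_at (n : nat) (k l : 'I_n) (R : seq (bool * 'I_n)) (i : nat) :
    nat :=
  if R is t :: R' then
    if (t.2 == k) && (nodes_on k R' == i) then nodes_on l R'
    else nodes_at k l R' i
  else 0%N.

Lemma nodes_at_le (n : nat) (k l : 'I_n) (R : seq (bool * 'I_n)) (i : nat) :
  (nodes_at k l R i <= nodes_on l R)%N.
Proof.
elim: R => //= t R IH; case: ifP => _; first exact: leq_addl.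
exact: leq_trans IH (leq_addl _ _).
Qed.

Lemma nodes_at_mono (n : nat) (k l : 'I_n) (R : seq (bool * 'I_n)) (i j : nat) :
  (i <= j < nodes_on k R)%N -> (nodes_at k l R i <= nodes_at k l R j)%N.
Proof.
elim: R => [|t R IH] /=; first by rewrite ltn0 andbF.
have := nodes_at_le k l R i; rewrite -/(nodes_on k R).
case: (t.2 == k) => /= le_i ij; last exact: IH.
case: (nodes_on k R =P j) => nj; case: eqP => ni //; first by lia.
by apply: IH; lia.
Qed.

Lemma pairing_level (n : nat) (k : 'I_n) (R : seq (bool * 'I_n)) (c e : nat) :
  all fst R -> (c < nodes_on k R)%N -> (e < nodes_on k R)%N ->
  pairing R (k, c) (k, e) = (e == c.+1)%:R - (c == e.+1)%:R.
Proof.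
(* For the induction, the node where the two strings meet, numbered by the larger of [c] and [e],
   must be required to lie in the prefix. *)
suff gen : all fst R -> pairing R (k, c) (k, e) =
    ((e == c.+1) && (e <= nodes_on k R)%N)%:R -
    ((c == e.+1) && (c <= nodes_on k R)%N)%:R.
  by move=> posR cR eR; rewrite gen // !(ltnW cR, ltnW eR) !andbT.
elim: R => [|[b l] R IH] /=.
  by lia.
case: b => //= posR; rewrite IH // /cross /active -/(nodes_on k R) mul1r /=.
have [lk|_] := eqVneq l k; last by rewrite !add0n; ring.
by rewrite add1n; lia.
Qed.

(** The string [(k, c.+1)] runs from node [c] to node [c.+1] of level [k]. Between them the terms
    telescope to the drop of [active z], and the end nodes contribute the same values once more,
    whence the factor 2. In the inner case the string has begun but not ended. *)
Lemma pairing_cross (n : nat) (k : 'I_n) (R : seq (bool * 'I_n))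
    (z : 'I_n * nat) (c : nat) :
  all fst R -> z.1 != k ->
  pairing R z (k, c.+1) =
  if (nodes_on k R <= c)%N then 0
  else 2 * (nodes_at k z.1 R c == z.2)%:R -
    (if nodes_on k R == c.+1 then active z R
     else 2 * (nodes_at k z.1 R c.+1 == z.2)%:R).
Proof.
move=> + zk; elim: R => [//|[b l] R IH] /=.
case: b => //= posR; rewrite IH // /cross mul1r.
have actk Q : active (k, c.+1) Q = (nodes_on k Q == c.+1)%:R by [].
have actz : (nodes_on z.1 R == z.2)%:R = active z R by [].
rewrite !actk /= -/(nodes_on k R).
have [lk|lk] := eqVneq l k.
  rewrite (_ : active z ((true, l) :: R) = active z R); last first.
    by rewrite active_cons //= lk eq_sym.
  rewrite add1n /=.
  have [mc|mc|mc] := ltngtP (nodes_on k R) c.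
  - by rewrite !ltn_eqF ?mulr0 ?subrr; lia.
  - rewrite !(gtn_eqF (_ : c.+1 < (nodes_on k R).+1)%N) //.
    case: (nodes_on k R =P c.+1) => mc1; rewrite /= ?actz; first by ring.
    by rewrite !mulr0 ?subr0 ?addr0.
  - rewrite mc eqxx ltn_eqF // actz /= !mulr0 ?subr0 mulr1; ring.
rewrite /= add0n; have [mc|mc] := leqP (nodes_on k R) c.
  by rewrite ltn_eqF ?mulr0 ?subrr // ltnS.
case: (nodes_on k R =P c.+1) => mc1; rewrite /=; first by ring.
by rewrite !mulr0 ?subr0 ?addr0.
Qed.

Lemma pairing_cons_closed (n : nat) (R : seq (bool * 'I_n)) (t : bool * 'I_n) :
  {in closed_labels R &, pairing (t :: R) =2 pairing R}.
Proof.
move=> x y xR yR; rewrite /= /cross !(active_closed xR) !(active_closed yR).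
by rewrite mul0r mulr0 subrr mulr0 addr0.
Qed.

Lemma in_Pprime_cons (n : nat) (A : 'M[int]_n) (d : 'I_n -> int)
    (R : seq (bool * 'I_n)) (k : 'I_n) :
  (forall i, A i i = 2) -> (forall i j, i != j -> A i j <= 0) ->
  (forall i, 0 < d i) -> (forall i j, d i * A i j = d j * A j i) ->
  all fst R -> in_Pprime A R -> in_Pprime A ((true, k) :: R).
Proof.
move=> A2 A0 d0 dA posR pR; set R1 := _ :: R; set K := nodes_on k R.
have onR1 l : nodes_on l R1 = ((k == l) + nodes_on l R)%N by [].
have entryR : {in closed_labels R &, forall x y, entry A R x y = entry A R1 x y}.
  by move=> x y xR yR; rewrite /entry pairing_cons_closed.
(* The first node on its level closes no string, so the matrix is unchanged. *)
have [K0|K0] := posnP K.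
  have R1E : closed_labels R =i closed_labels R1.
    move=> [l c]; rewrite !mem_closed_labels onR1 /=.
    by have [<-|//] := eqVneq k l; rewrite -/K; lia.
  by apply: restriction_eq pR => // x y; rewrite -!R1E; apply: entryR.
pose v := (k, K); pose M := row_mutation k K (entry A R1) K.-1.
have ltK : (K.-1 < K)%N by lia.
have R1E : v :: closed_labels R =i closed_labels R1.
  move=> [l c]; rewrite inE !mem_closed_labels onR1 xpair_eqE /=.
  rewrite (eq_sym l k); have [<-|//] := eqVneq k l; rewrite -/K; lia.
have ks j : (0 < j < K)%N -> (k, j) \in closed_labels R.
  by rewrite mem_closed_labels.
have ksv j : (0 < j < K)%N -> (k, j) \in v :: closed_labels R.
  by move=> /ks jR; rewrite inE jR orbT.
(* The mutated labels are closed in [R], so these mutations commute with deleting [v]. *)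
have pM : Pprime (restriction (closed_labels R) M).
  apply: (restriction_row_mutation _ ks ltK).1.
  exact: restriction_eq pR.
suff pvM : Pprime (restriction (v :: closed_labels R) M).
  apply: restriction_eq R1E _ _ => //.
  exact: (restriction_row_mutation _ ksv ltK).2.
apply: (@restriction_extension _ _ _ (fun x => d x.1)) => //.
- by rewrite mem_closed_labels /= ltnn andbF.
- apply: row_mutation_skew => // x y; rewrite !R1E.
  exact: entry_skew.
(* What is left is the sign of the column of [v], read off [row_mutation_column] after [K.-1]
   mutations, at [j] = 0. *)
pose s := [pred z | (z \in closed_labels R) && (z.1 != k)].
pose Z (z : 'I_n * nat) i := nodes_at k z.1 R1 i == z.2.
have inR1 z : z \in closed_labels R -> z \in closed_labels R1.
  by rewrite -R1E inE => ->; rewrite orbT.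
have kR1 j : (0 < j <= K)%N -> (k, j) \in closed_labels R1.
  by rewrite mem_closed_labels onR1 eqxx.
have [] := @row_mutation_column n k K (entry A R1) s (fun z => A z.1 k) Z
  _ _ _ _ _ _ K.-1 0%N.
- move=> c e cK eK; have := entryE A2 (kR1 c cK) (kR1 e eK).
  by rewrite [A _ _]A2 pairing_level ?onR1 ?eqxx -/K //; lia.
- move=> z j /andP[zR zk] jK; have := entryE A2 (inR1 _ zR) (kR1 j jK).
  case: j jK => // j jK; rewrite pairing_cross // /Z.
  have [-> ->] : (nodes_on k R1 <= j)%N = false /\ (nodes_on k R1 == j.+1) = false.
    by rewrite onR1 eqxx -/K; lia.
  by rewrite -mulrBr mulrCA => /mulfI ->.
- by move=> z /andP[].
- by move=> z /andP[_ zk]; apply: A0.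
(* Node [K], counted from 0, is the last node of [R1], where [z] has already ended. *)
- move=> z /andP[]; rewrite mem_closed_labels => /andP[_ zR] _.
  by rewrite /Z /= !eqxx gtn_eqF.
- move=> z i j /andP[zR zk] ijK /eqP ZK /eqP Zi; apply/eqP.
  have := @nodes_at_mono n k z.1 R1 i j; have := @nodes_at_mono n k z.1 R1 j K.-1.
  rewrite ZK Zi onR1 eqxx; lia.
- by lia.
(* Off level [k] the column is a nonpositive Cartan entry times indicators; on it, the only possible
   nonzero entry is -1 at [(k, 1)]. *)
move=> _ _ Mz Mk [l c] lcR.
have [lk|lk] := eqVneq l k.
  by rewrite lk /M /v Mk; move: lcR; rewrite lk mem_closed_labels /= -/K; lia.
rewrite /M /v Mz ?inE ?lcR //=.
by rewrite -mulrA mulr_le0_ge0 ?A0 // mulr_ge0.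
Qed.

Lemma in_Pprime_word (n : nat) (A : 'M[int]_n) (d : 'I_n -> int)
    (R : seq (bool * 'I_n)) :
  (forall i, A i i = 2) -> (forall i j, i != j -> A i j <= 0) ->
  (forall i, 0 < d i) -> (forall i j, d i * A i j = d j * A j i) ->
  in_Pprime A R.
Proof.
move=> A2 A0 d0 dA; have [m] := ubnP (size R).
elim: m R => // m IH R le_m; apply: in_Pprime_positive => // R' sR'.
case: R' sR' => [|[[] k] R'] //= sR' posR'; last first.
  by apply: (in_Pprime_cons (d := d)) => //; apply: IH; rewrite -sR' in le_m.
apply: Pprime_empty; apply: eq_card0 => x; have := ssvalP x.
by rewrite mem_closed_labels ltn0 andbF.
Qed.

(** * From closed strings of a triangulation to labels *)

Definition prefix_nodes (n : nat) (T : seq (bool * 'I_n)) (k : 'I_n) (m : nat) :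
    nat :=
  nodes_on k (rev (take m T)).

Lemma prefix_nodesS (n : nat) (T : seq (bool * 'I_n)) (k : 'I_n)
    (m : 'I_(size T)) :
  prefix_nodes T k m.+1 = (prefix_nodes T k m + (node_level m == k))%N.
Proof.
rewrite /prefix_nodes (take_nth (tnth (in_tuple T) m)) // rev_rcons addnC.
by rewrite /node_level [in RHS](tnth_nth (tnth (in_tuple T) m)).
Qed.

Lemma prefix_nodes_le (n : nat) (T : seq (bool * 'I_n)) (k : 'I_n) (m m' : nat) :
  (m <= m')%N -> (prefix_nodes T k m <= prefix_nodes T k m')%N.
Proof.
move=> le_m; rewrite /prefix_nodes /nodes_on !count_rev -(subnKC le_m) takeD.
by rewrite count_cat leq_addr.
Qed.

Definition string_label (n : nat) (T : seq (bool * 'I_n)) (x : closed_string T) :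
    'I_n * nat :=
  (string_level x, prefix_nodes T (string_level x) (left_end x).+1).

Lemma left_right_end (n : nat) (T : seq (bool * 'I_n)) (x : closed_string T) :
  (left_end x < right_end x)%N.
Proof. by have /and3P[] := valP x. Qed.

Lemma inner_level (n : nat) (T : seq (bool * 'I_n)) (x : closed_string T)
    (m : 'I_(size T)) :
  (left_end x < m < right_end x)%N -> node_level m != string_level x.
Proof. by have /and3P[_ _ /forallP/(_ m)/implyP] := valP x. Qed.

Lemma prefix_nodes_string (n : nat) (T : seq (bool * 'I_n))
    (x : closed_string T) (m : nat) :
  (left_end x < m <= right_end x)%N ->
  prefix_nodes T (string_level x) m = (string_label x).2.
Proof.
elim: m => [|m IH]; first by rewrite ltn0.
rewrite ltnS leq_eqVlt => /andP[/orP[/eqP <- //|lm] mr].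
have mT : (m < size T)%N by apply: leq_trans (ltnW (ltn_ord (right_end x))).
have := prefix_nodesS (string_level x) (Ordinal mT) => /= ->.
by rewrite IH ?lm ?(ltnW mr) // (negPf (inner_level _)) ?addn0 //= lm.
Qed.

(** The count of nodes on the level of [x] grows at both ends of [x] and at no node in between; gap
    [m] lies just before node [m]. *)
Lemma active_string (n : nat) (T : seq (bool * 'I_n)) (x : closed_string T)
    (m : nat) :
  active (string_label x) (rev (take m T)) = (left_end x < m <= right_end x)%:R.
Proof.
rewrite /active -/(prefix_nodes _ _ _) /=; congr (nat_of_bool _)%:R.
have := left_right_end x.
have [lm lr|lm _] /= := ltnP (left_end x) m; last first.
  rewrite ltn_eqF // (leq_ltn_trans (prefix_nodes_le T _ lm)) //.
  by rewrite prefix_nodesS eqxx addn1.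
have [mr|mr] := leqP m (right_end x).
  by apply/eqP; apply: prefix_nodes_string; rewrite lm.
rewrite gtn_eqF // (leq_trans _ (prefix_nodes_le T _ mr)) //.
rewrite (prefix_nodesS _ (right_end x)) right_end_level eqxx addn1 ltnS.
by rewrite (@prefix_nodes_string _ _ x (right_end x)) ?lr ?leqnn.
Qed.

Lemma string_label_closed (n : nat) (T : seq (bool * 'I_n)) (x : closed_string T) :
  string_label x \in closed_labels (rev T).
Proof.
rewrite mem_closed_labels; apply/andP; split.
  by rewrite /= prefix_nodesS eqxx addn1.
rewrite -(@prefix_nodes_string _ _ x (right_end x)) ?left_right_end ?leqnn //.
have -> : rev T = rev (take (size T) T) by rewrite take_size.
apply: leq_trans (prefix_nodes_le T _ (ltn_ord (right_end x))).
by rewrite prefix_nodesS right_end_level eqxx addn1.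
Qed.

(** [h] and [h'] are the activities of [x] just before and just after [m]; this reduces
    [node_entryE] to a finite case check. *)
Lemma string_node (n : nat) (T : seq (bool * 'I_n)) (x : closed_string T)
    (m : 'I_(size T)) :
  let h := (left_end x < m <= right_end x)%N in
  let h' := (left_end x < m.+1 <= right_end x)%N in
  if node_level m == string_level x then
    [/\ left_of x m = h, right_of x m = h' & ~~ (h && h')]
  else [/\ left_of x m = false, right_of x m = false,
           intersects x m = h & h' = h].
Proof.
move=> h h'; rewrite /left_of /right_of /intersects.
have lr := left_right_end x; have := @inner_level _ _ x m.
have [lvl in_m|lvl _] := eqVneq (node_level m) (string_level x).
  have {}in_m : ~~ (left_end x < m < right_end x)%N by apply/negP => /in_m.
  by rewrite -!val_eqE /=; split; rewrite /h /h'; lia.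
have neq e : node_level e = string_level x -> (e == m) = false.
  by move=> el; apply/negbTE/eqP => em; move: lvl; rewrite -em el eqxx.
have ml := neq _ (erefl : node_level (left_end x) = _).
have mr := neq _ (right_end_level x).
by rewrite ml mr; move: ml mr; rewrite -!val_eqE /= /h /h'; split; lia.
Qed.

(** A label fixes the gaps where its string is active, and these fix both ends. *)
Lemma string_label_inj (n : nat) (T : seq (bool * 'I_n)) :
  injective (@string_label n T).
Proof.
move=> x y exy; have act m : (left_end x < m <= right_end x)%N =
    (left_end y < m <= right_end y)%N.
  have := active_string x m; rewrite exy active_string => /eqP.
  by rewrite eqr_nat; do 2!case: (_ < _ <= _)%N.
have := act (left_end x).+1; have := act (right_end x).
have := act (left_end y).+1; have := act (right_end y).
have := left_right_end x; have := left_right_end y => lry lrx a b c d.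
have lxy : left_end x = left_end y by apply: val_inj; move: a b c d => /=; lia.
have rxy : right_end x = right_end y by apply: val_inj; move: a b c d => /=; lia.
apply: val_inj; rewrite [val x]surjective_pairing [val y]surjective_pairing.
by congr (_, _).
Qed.

Lemma node_of_prefix (n : nat) (T : seq (bool * 'I_n)) (k : 'I_n) (c : nat) :
  (c < nodes_on k (rev T))%N ->
  exists2 m : 'I_(size T), node_level m = k & prefix_nodes T k m = c.
Proof.
move=> lt_c; have exP : exists m, (c < prefix_nodes T k m)%N.
  by exists (size T); rewrite /prefix_nodes take_size.
case: (ex_minnP exP) => [[|m]]; first by rewrite /prefix_nodes take0.
move=> cm min_m; have mT : (m < size T)%N.
  by apply: min_m; rewrite /prefix_nodes take_size.
have := prefix_nodesS k (Ordinal mT) => /= cS.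
have le_c : (prefix_nodes T k m <= c)%N.
  by rewrite leqNgt; apply/negP => /min_m; rewrite ltnn.
by exists (Ordinal mT); move: cm cS => /=; case: eqP => //=; lia.
Qed.


Lemma string_label_surj (n : nat) (T : seq (bool * 'I_n)) (u : 'I_n * nat) :
  u \in closed_labels (rev T) -> exists x : closed_string T, string_label x == u.
Proof.
case: u => k [|c]; rewrite mem_closed_labels //= => lt_c.
(* [prefix_nodes] at a node leaves that node out, so the ends are preceded by [c] and [c.+1] nodes
   of level [k]. *)
have [l lk lc] := node_of_prefix (ltnW lt_c).
have [r rk rc] := node_of_prefix lt_c.
have lr : (l < r)%N.
  by rewrite ltnNge; apply/negP => /(prefix_nodes_le T k); rewrite lc rc ltnn.
have x_closed : is_closed_string (l, r).
  rewrite /is_closed_string /= lr lk rk eqxx /=; apply/forallP => m.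
  apply/implyP => /andP[lm mr]; apply/negP => /eqP mk.
  have := prefix_nodes_le T k mr; have := prefix_nodes_le T k lm.
  by rewrite !prefix_nodesS lc rc lk mk eqxx; lia.
exists (Sub (l, r) x_closed); apply/eqP; rewrite /string_label /string_level.
by rewrite /left_end SubK /= lk prefix_nodesS lc lk eqxx addn1.
Qed.

Lemma pairing_sum (n : nat) (T : seq (bool * 'I_n)) (u w : 'I_n * nat) :
  (pairing (rev T) u w)%:~R = \sum_(m < size T) node_sign m *
    (cross (rev (take m T)) (rev (take m.+1 T)) u w)%:~R :> rat.
Proof.
(* Indexing by [nat] lets the induction compare the summands of [T] and [rcons T t]. *)
pose G (T : seq (bool * 'I_n)) (m : nat) : rat :=
  (sign_of (nth true (unzip1 T) m) *
    cross (rev (take m T)) (rev (take m.+1 T)) u w)%:~R.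
transitivity (\sum_(m < size T) G T m).
  elim/last_ind: T => [|T t IH]; first by rewrite big_ord0.
  rewrite rev_rcons /= intrD IH size_rcons big_ord_recr /=; congr (_ + _).
    apply: eq_bigr => m _; rewrite /G /unzip1 map_rcons nth_rcons size_map ltn_ord.
    by rewrite -!cats1 !takel_cat // ltnW.
  rewrite /G /unzip1 map_rcons nth_rcons size_map ltnn eqxx.
  rewrite -cats1 takel_cat // take_size take_oversize ?size_cat ?addn1 //.
  by rewrite cats1 rev_rcons.
apply: eq_bigr => m _; rewrite /G intrM; congr (_ * _).
rewrite /node_sign (tnth_nth (true, (tnth (in_tuple T) m).2)) /=.
rewrite /unzip1 (nth_map (true, (tnth (in_tuple T) m).2)) //.
by case: (nth _ _ _).1.
Qed.

(** On one level the factor a_kk / 2 = 1 yields the entries of two adjacent strings, so a single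
    formula covers all cases of [node_entry]. *)
Lemma node_entryE (n : nat) (A : 'M[int]_n) (T : seq (bool * 'I_n))
    (m : 'I_(size T)) (x y : closed_string T) :
  (forall i, A i i = 2) ->
  node_entry A m x y = (A (string_level x) (string_level y))%:~R / 2 *
    (node_sign m * (cross (rev (take m T)) (rev (take m.+1 T))
       (string_label x) (string_label y))%:~R).
Proof.
move=> A2; rewrite /cross !active_string intrB !intrM.
have := string_node x m; have := string_node y m; cbv zeta.
move: (left_end y < m <= _)%N (left_end y < m.+1 <= _)%N => hy hy'.
move: (left_end x < m <= _)%N (left_end x < m.+1 <= _)%N => hx hx'.
have [xy|xy] := eqVneq (string_level x) (string_level y).
  rewrite /node_entry /crosses -xy A2 divff // mul1r.
  case: eqVneq => [mx|mx]; last first.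
    move=> [-> -> _ ->] [-> -> _ ->].
    by rewrite /= !andbF subrr mulr0.
  move=> [-> -> nhy] [-> -> nhx].
  rewrite /= !andbF.
  by case: hx hx' hy hy' nhx nhy => [] [] [] [] //= _ _; ring.
rewrite node_entry_diff_level // -!/(left_of _ m) -!/(right_of _ m).
move=> Hy Hx; congr (_ * _); move: Hy Hx; case: eqVneq => [my|my].
  rewrite my eq_sym (negPf xy) => -[-> -> _] [-> -> -> ->].
  by case: hx hy hy' => [] [] []; ring.
move=> [-> -> -> ->]; case: eqVneq => [mx|mx] [-> ->].
  by move=> _; case: hx hx' hy => [] [] []; ring.
by move=> _ ->; ring.
Qed.

Lemma exchange_matrix_entry (n : nat) (A : 'M[int]_n) (T : seq (bool * 'I_n))
    (x y : closed_string T) :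
  (forall i, A i i = 2) ->
  exchange_matrix A T x y = entry A (rev T) (string_label x) (string_label y).
Proof.
move=> A2; apply: (intr_inj (R := rat)); rewrite exchange_matrixE.
under eq_bigr do rewrite node_entryE //.
rewrite -mulr_sumr -pairing_sum.
have := entryE A2 (string_label_closed x) (string_label_closed y).
move=> /(congr1 (fun z : int => z%:~R : rat)); rewrite !intrM /= => E.
by rewrite mulrAC -E mulrAC divff ?mul1r.
Qed.

Theorem theorem1p1 (n : nat) (A : 'M[int]_n) (i j : seq 'I_n)
  (T : seq (bool * 'I_n))
  (hA : symmetrizable_gcm A) (hT : is_triangulation i j T) :
  Pprime (exchange_matrix A T).
Proof.
case: hA => A2 A0 _ [d [d_gt0 dA]].
have dA' k l : d 0 k * A k l = d 0 l * A l k.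
  have := congr1 (fun M : 'M_n => M l k) dA.
  by rewrite mxE !mul_diag_mx !mxE.
pose h (u : seq_sub (closed_labels (rev T))) :=
  xchoose (string_label_surj (ssvalP u)).
have hK u : string_label (h u) = ssval u.
  exact/eqP/(xchooseP (string_label_surj (ssvalP u))).
apply: (Pprime_reindex (h := h) _ _ (in_Pprime_word (rev T) A2 A0 d_gt0 dA')).
  exists (fun x => SeqSub (string_label_closed x)) => [u|x].
    by apply: val_inj; rewrite /= hK.
  by apply: string_label_inj; rewrite hK.
by move=> u w; rewrite exchange_matrix_entry // !hK !ffunE.
Qed.
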